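(* Let $\overline{A},\overline{B}$ be cardinalities with spaces $\mathcal{A},\mathcal{B}$. Any behavior $\vec P\in\mathcal{A}\otimes\mathcal{B}$ has the form $$\vec P=\vec Z_{\mathcal A}\otimes\vec Z_{\mathcal B}+\vec P^{\,\mathrm{nonsig}}+\vec P^{\,\mathrm A\to\mathrm B}+\vec P^{\,\mathrm B\to\mathrm A},$$ where the nonsignaling component satisfies $\vec P^{\,\mathrm{nonsig}}\in(\mathsf{Z}_{\mathcal A}\otimes\mathsf{C}_{\mathcal B})\oplus(\mathsf{C}_{\mathcal A}\otimes\mathsf{Z}_{\mathcal B})\oplus(\mathsf{C}_{\mathcal A}\otimes\mathsf{C}_{\mathcal B})$, the component expressing signaling from $\mathrm A$ to $\mathrm B$ satisfies $\vec P^{\,\mathrm A\to\mathrm B}\in\mathsf{S}_{\mathcal A}\otimes\mathsf{C}_{\mathcal B}$, and the component expressing signaling from $\mathrm B$ to $\mathrm A$ satisfies $\vec P^{\,\mathrm B\to\mathrm A}\in\mathsf{C}_{\mathcal A}\otimes\mathsf{S}_{\mathcal B}$.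
   Context: A cardinality $\overline{A}=(A_1,\dots,A_X)$ is a finite nonempty sequence of positive integers: a device has inputs $x\in\{1,\dots,X\}$ and, for input $x$, outputs $a\in\{1,\dots,A_x\}$. The associated space is $\mathcal{A}=\mathbb{R}^{\sum_x A_x}$ with standard basis $[a|x]$; elements of $\mathcal{A}\otimes\mathcal{B}$ have coordinates $P(ab|xy)$. A behavior is a conditional probability distribution: $P(ab|xy)\ge0$ and $\sum_{ab}P(ab|xy)=1$ for all $x,y$. Define $\vec Z_{\mathcal A}=\sum_{x=1}^X\sum_{a=1}^{A_x}\frac{1}{A_x}[a|x]$; $\vec C_{\mathcal A}^{\,i|x}=\frac{1}{A_x}([i|x]-[A_x|x])$ for $x\in\{1,\dots,X\}$, $i\in\{1,\dots,A_x-1\}$; $\vec S_{\mathcal A}^{\,k}=\sum_{a=1}^{A_k}\frac{X}{A_k}[a|k]-\sum_{x=1}^X\sum_{a=1}^{A_x}\frac{1}{A_x}[a|x]$ for $k\in\{1,\dots,X-1\}$; and $\mathsf{Z}_{\mathcal A}=\mathrm{span}(\vec Z_{\mathcal A})$, $\mathsf{C}_{\mathcal A}=\mathrm{span}\{\vec C_{\mathcal A}^{\,i|x}\}_{i,x}$, $\mathsf{S}_{\mathcal A}=\mathrm{span}\{\vec S_{\mathcal A}^{\,k}\}_k$. One has $\mathcal{A}=\mathsf{C}_{\mathcal A}\oplus\mathsf{Z}_{\mathcal A}\oplus\mathsf{S}_{\mathcal A}$. The analogous objects for $\mathcal{B}$ are defined in the same way from $\overline{B}$. *)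

(* Defs.v *)
From HB Require Import structures.
From mathcomp Require Import all_boot all_order all_algebra.
From mathcomp Require Import reals.

Set Implicit Arguments.
Unset Strict Implicit.
Unset Printing Implicit Defensive.

Import Order.TTheory GRing.Theory Num.Theory.
Local Open Scope ring_scope.

Record cardinality := Cardinality {
  inputs : nat;
  outputs :> 'I_inputs -> nat;
  inputs_gt0 : (0 < inputs)%N;
  outputs_gt0 : forall x : 'I_inputs, (0 < outputs x)%N }.

(* The index set of the basis [a|x]. Inputs and outputs are numbered from 0:
   the ordinal i stands for the label i + 1. *)
Definition outcome (A : cardinality) : finType :=
  {x : 'I_(inputs A) & 'I_(A x)}.

Definition out (A : cardinality) (x : 'I_(inputs A)) (a : 'I_(A x)) :
  outcome A := Tagged (fun x => 'I_(A x)) a.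

Lemma last_output_subproof (A : cardinality) (x : 'I_(inputs A)) :
  ((A x).-1 < A x)%N.
Proof. by rewrite ltn_predL outputs_gt0. Qed.

(* The output labelled A_x. *)
Definition last_output (A : cardinality) (x : 'I_(inputs A)) : 'I_(A x) :=
  Ordinal (last_output_subproof x).

(* [R^o] is R as a module over itself, so that these are vector spaces. *)
Notation space R A := {ffun outcome A -> R^o}.

(* The tensor product of two coordinate spaces, in coordinates:
   P(ab|xy) is [P (out a, out b)], where a : 'I_(A x) and b : 'I_(B y). *)
Notation tensor_space R A B := {ffun outcome A * outcome B -> R^o}.

Section Device.
Variables (R : realType) (A : cardinality).
Local Notation X := (inputs A).

Definition ket (x : 'I_X) (a : 'I_(A x)) : space R A :=
  [ffun o => (o == out a)%:R].

Definition Zvec : space R A :=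
  \sum_(x < X) \sum_(a < A x) (A x)%:R^-1 *: ket a.

Definition Cvec (x : 'I_X) (i : 'I_(A x)) : space R A :=
  (A x)%:R^-1 *: (ket i - ket (last_output x)).

Definition Svec (k : 'I_X) : space R A :=
  \sum_(a < A k) (X%:R / (A k)%:R) *: ket a
  - \sum_(x < X) \sum_(a < A x) (A x)%:R^-1 *: ket a.

Definition Zspace : {vspace space R A} := <[Zvec]>%VS.

Definition Cspace : {vspace space R A} :=
  <<[seq Cvec (tagged o) |
       o : outcome A in [pred o : outcome A | (tagged o).+1 < A (tag o)]%N]>>%VS.

Definition Sspace : {vspace space R A} :=
  <<[seq Svec k | k : 'I_X in [pred k : 'I_X | k.+1 < X]%N]>>%VS.

End Device.

Section Bipartite.
Variables (R : realType) (A B : cardinality).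

Definition tens (u : space R A) (v : space R B) : tensor_space R A B :=
  [ffun o => u o.1 * v o.2].

(* The choice of bases is immaterial: by [tensv_mem] and [tensv_min] below,
   this is the smallest subspace containing u (x) v for all u in U, v in V. *)
Definition tensv (U : {vspace space R A}) (V : {vspace space R B}) :
  {vspace tensor_space R A B} :=
  <<[seq tens u v | u <- vbasis U, v <- vbasis V]>>%VS.

Definition behavior (P : tensor_space R A B) : Prop :=
  (forall (x : 'I_(inputs A)) (y : 'I_(inputs B)) (a : 'I_(A x)) (b : 'I_(B y)),
     (0 : R) <= P (out a, out b))
  /\ (forall (x : 'I_(inputs A)) (y : 'I_(inputs B)),
     \sum_(a < A x) \sum_(b < B y) P (out a, out b) = 1 :> R).

Lemma tensv_mem (U : {vspace space R A}) (V : {vspace space R B}) u v :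
  u \in U -> v \in V -> tens u v \in tensv U V.
Proof.
move=> Uu Vv; rewrite (coord_vbasis Uu) (coord_vbasis Vv).
set cu := coord _; set cv := coord _.
have -> : tens (\sum_i cu i u *: (vbasis U)`_i) (\sum_j cv j v *: (vbasis V)`_j)
  = \sum_i \sum_j (cu i u * cv j v) *: tens (vbasis U)`_i (vbasis V)`_j.
  apply/ffunP=> o; rewrite ffunE !sum_ffunE mulr_suml; apply: eq_bigr => i _.
  rewrite sum_ffunE mulr_sumr; apply: eq_bigr => j _.
  by rewrite !ffunE /GRing.scale /= mulrACA.
apply: memv_suml => i _; apply: memv_suml => j _; apply/memvZ/memv_span.
by apply/allpairsP; exists ((vbasis U)`_i, (vbasis V)`_j);
  split; rewrite //= mem_nth // size_tuple.
Qed.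

Lemma tensv_min (U : {vspace space R A}) (V : {vspace space R B})
    (W : {vspace tensor_space R A B}) :
  (forall u v, u \in U -> v \in V -> tens u v \in W) -> (tensv U V <= W)%VS.
Proof.
move=> UVW; apply/span_subvP => _ /allpairsP[[u v] [Uu Vv ->]].
by apply: UVW; apply: vbasis_mem.
Qed.

End Bipartite.

(* Main.v *)
(* Averaging a vector over the outputs of each input is a projector which
   vanishes on C, fixes Z, and sends [a|x] to the uniform vector D_x. Hence
   [a|x] is the sum of an element of C and of D_x = (S^x + Z) / X, and P expands
   into terms in C (x) C, C (x) D_y, D_x (x) C and D_x (x) D_y. By normalization
   the last ones add up to \sum_(x, y) D_x (x) D_y = Z (x) Z. Averaging on one
   side of a tensor product also separates the summands in the direct sum. *)
Require Import Defs.
From HB Require Import structures.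
From mathcomp Require Import all_boot all_order all_algebra.
From mathcomp Require Import reals.
Set Implicit Arguments.
Unset Strict Implicit.
Unset Printing Implicit Defensive.
Import Order.TTheory GRing.Theory Num.Theory.
Local Open Scope ring_scope.

(** * Averages over outputs, and membership in C and S for one party *)

Section Device.
Variables (R : realType) (A : cardinality).
Local Notation X := (inputs A).

Lemma sum_outcome (V : nmodType) (F : outcome A -> V) :
  \sum_o F o = \sum_(x < X) \sum_(a < A x) F (out a).
Proof.
rewrite (sig_big_dep xpredT (fun _ => xpredT) (fun x a => F (out a))) /=.
by apply: eq_bigr => -[x a] _.
Qed.

Lemma sum_eq_out (o : outcome A) (x : 'I_X) :
  \sum_(a < A x) ((o == out a)%:R : R) = (tag o == x)%:R.
Proof.
case: o => y b /=; have [<-|yx] := eqVneq y x; last first.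
  rewrite big1 // => a _; case: eqP => // /(congr1 tag) /= e.
  by rewrite e eqxx in yx.
rewrite (bigD1 b) //= eqxx big1 ?addr0 // => a ab.
by rewrite /out eq_Tagged /= eq_sym (negPf ab).
Qed.

Lemma out_tagged (o : outcome A) : out (tagged o) = o.
Proof. by case: o. Qed.

Lemma outputs_neq0 (x : 'I_X) : (A x)%:R != 0 :> R.
Proof. by rewrite pnatr_eq0 -lt0n outputs_gt0. Qed.

Lemma inputs_neq0 : X%:R != 0 :> R.
Proof. by rewrite pnatr_eq0 -lt0n inputs_gt0. Qed.

Definition avg (u : Defs.space R A) : Defs.space R A :=
  [ffun o => (A (tag o))%:R^-1 * \sum_(a < A (tag o)) u (out a)].

Lemma avg_is_linear : linear avg.
Proof.
move=> k u v; apply/ffunP=> o; rewrite !ffunE /GRing.scale /=.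
under eq_bigr => a _ do rewrite !ffunE.
by rewrite big_split /= -mulr_sumr mulrDr mulrCA.
Qed.
HB.instance Definition _ :=
  GRing.isLinear.Build R (Defs.space R A) (Defs.space R A) _ avg avg_is_linear.

Definition uniform (x : 'I_X) : Defs.space R A :=
  [ffun o => (A x)%:R^-1 * (tag o == x)%:R].

Lemma uniform_sum_ket (x : 'I_X) :
  uniform x = (A x)%:R^-1 *: \sum_(a < A x) ket R a.
Proof.
apply/ffunP=> o; rewrite !ffunE sum_ffunE -sum_eq_out /GRing.scale /=.
by congr (_ * _); apply: eq_bigr => a _; rewrite ffunE.
Qed.

Lemma avg_ket (x : 'I_X) (a : 'I_(A x)) : avg (ket R a) = uniform x.
Proof.
apply/ffunP=> -[y b]; rewrite !ffunE /=.
under eq_bigr => c _ do rewrite ffunE eq_sym.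
rewrite sum_eq_out /= eq_sym.
by have [->|] := eqVneq y x; rewrite ?mulr0.
Qed.

Lemma sum_uniform : \sum_x uniform x = Zvec R A.
Proof.
by apply: eq_bigr => x _; rewrite uniform_sum_ket scaler_sumr.
Qed.

Lemma ZvecE (o : outcome A) : Zvec R A o = (A (tag o))%:R^-1 :> R.
Proof.
rewrite -sum_uniform sum_ffunE (bigD1 (tag o)) //= ffunE eqxx mulr1.
by rewrite big1 ?addr0 // => x xo; rewrite ffunE eq_sym (negPf xo) mulr0.
Qed.

Lemma avg_Zvec : avg (Zvec R A) = Zvec R A.
Proof.
apply/ffunP=> o; rewrite ffunE ZvecE; under eq_bigr => a _ do rewrite ZvecE /=.
rewrite sumr_const card_ord -[X in _ * X]mulr_natr.
apply: etrans (mulr1 _); congr (_ * _).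
exact: mulVf (outputs_neq0 _).
Qed.

Lemma SvecE (k : 'I_X) : Svec R k = X%:R *: uniform k - Zvec R A.
Proof. by rewrite uniform_sum_ket scalerA scaler_sumr. Qed.

Lemma Zspace_avg u : u \in Zspace R A -> avg u = u.
Proof. by case/vlineP=> k ->; rewrite linearZ /= avg_Zvec. Qed.

(** The two kets in a generator belong to the same input, so they have the same average, and the
    kernel of [avg] contains the whole span. *)
Lemma Cspace_avg u : u \in Cspace R A -> avg u = 0.
Proof.
have/subvP CK : (Cspace R A <= lker (linfun avg))%VS.
  apply/span_subvP=> _ /imageP[o _ ->].
  by rewrite memv_ker lfunE /= linearZ linearB /= !avg_ket subrr scaler0.
by move=> /CK; rewrite memv_ker lfunE => /eqP.
Qed.

(** The generators leave out the last output, but there [Cvec] is 0. *)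
Lemma mem_Cvec (x : 'I_X) (i : 'I_(A x)) : Cvec R i \in Cspace R A.
Proof.
have [iA|Ai] := ltnP i.+1 (A x).
  by apply/memv_span/imageP; exists (out i).
suff -> : i = last_output x by rewrite /Cvec subrr scaler0 mem0v.
by apply/val_inj/eqP; rewrite /= eqn_leq -ltnS prednK ?outputs_gt0 // ltn_ord /=
  -ltnS prednK ?outputs_gt0.
Qed.

Definition ketC (o : outcome A) : Defs.space R A :=
  ket R (tagged o) - uniform (tag o).

Lemma ketE (o : outcome A) : ket R (tagged o) = ketC o + uniform (tag o).
Proof. by rewrite subrK. Qed.

(** In [Cvec R a - Cvec R i] the ket of the last output cancels, leaving the difference of two kets
    over A_x; summing over i replaces the second ket by its average. *)
Lemma mem_ketC (o : outcome A) : ketC o \in Cspace R A.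
Proof.
case: o => x a; have -> : ketC (out a) = \sum_(i < A x) (Cvec R a - Cvec R i).
  under eq_bigr => i _ do rewrite /Cvec -scalerBr opprB addrA subrK.
  rewrite -scaler_sumr sumrB sumr_const card_ord -scaler_nat scalerBr scalerA.
  by rewrite mulVf ?outputs_neq0 // scale1r /ketC uniform_sum_ket.
by apply: memv_suml => i _; rewrite memvB ?mem_Cvec.
Qed.

Lemma sum_Svec : \sum_k Svec R k = 0 :> Defs.space R A.
Proof.
under eq_bigr => k _ do rewrite SvecE.
by rewrite sumrB -scaler_sumr sum_uniform sumr_const card_ord scaler_nat subrr.
Qed.

(** The generators leave out the last input; by [sum_Svec] its vector is minus the sum of all the
    others. *)
Lemma mem_Svec (k : 'I_X) : Svec R k \in Sspace R A.
Proof.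
have memS (j : 'I_X) : (j.+1 < X)%N -> Svec R j \in Sspace R A.
  by move=> jX; apply/memv_span/imageP; exists j.
have [/memS//|Xk] := ltnP k.+1 X.
have := sum_Svec; rewrite (bigD1 k) //= => /eqP; rewrite addr_eq0 => /eqP->.
rewrite memvN; apply: memv_suml => j jk; apply: memS.
rewrite ltn_neqAle ltn_ord andbT; apply: contraNneq jk => jX.
by apply/eqP/val_inj/eqP; rewrite -eqSS jX eqn_leq Xk ltn_ord.
Qed.

Lemma uniformE (x : 'I_X) : uniform x = X%:R^-1 *: (Svec R x + Zvec R A).
Proof. by rewrite SvecE subrK scalerA mulVf ?scale1r ?inputs_neq0. Qed.

End Device.

(** * Bilinearity of the tensor product, and averaging on one factor *)

Section Bipartite.
Variables (R : realType) (A B : cardinality).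
Local Notation tensor := (tensor_space R A B).

Lemma tensDl (u u' : Defs.space R A) (v : Defs.space R B) :
  tens (u + u') v = tens u v + tens u' v.
Proof. by apply/ffunP=> o; rewrite !ffunE mulrDl. Qed.

Lemma tensDr (u : Defs.space R A) (v v' : Defs.space R B) :
  tens u (v + v') = tens u v + tens u v'.
Proof. by apply/ffunP=> o; rewrite !ffunE mulrDr. Qed.

Lemma tensDD (u u' : Defs.space R A) (v v' : Defs.space R B) :
  tens (u + u') (v + v')
  = (tens u v + tens u v') + (tens u' v + tens u' v').
Proof. by rewrite tensDl !tensDr. Qed.

Lemma tensZl k (u : Defs.space R A) (v : Defs.space R B) :
  tens (k *: u) v = k *: tens u v.
Proof. by apply/ffunP=> o; rewrite !ffunE /GRing.scale /= mulrA. Qed.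

Lemma tensZr k (u : Defs.space R A) (v : Defs.space R B) :
  tens u (k *: v) = k *: tens u v.
Proof. by apply/ffunP=> o; rewrite !ffunE /GRing.scale /= mulrCA. Qed.

Lemma tens_sum (I J : finType)
    (u : I -> Defs.space R A) (v : J -> Defs.space R B) :
  tens (\sum_i u i) (\sum_j v j) = \sum_i \sum_j tens (u i) (v j).
Proof.
apply/ffunP=> o; rewrite ffunE !sum_ffunE mulr_suml; apply: eq_bigr => i _.
by rewrite sum_ffunE mulr_sumr; apply: eq_bigr => j _; rewrite ffunE.
Qed.

(** [avgl] and [avgr] are avg (x) id and id (x) avg, given in coordinates so that they are defined
    on every tensor, not only on products. *)
Definition avgl (T : tensor) : tensor :=
  [ffun p => (A (tag p.1))%:R^-1 * \sum_(a < A (tag p.1)) T (out a, p.2)].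

Definition avgr (T : tensor) : tensor :=
  [ffun p => (B (tag p.2))%:R^-1 * \sum_(b < B (tag p.2)) T (p.1, out b)].

Lemma avgl_is_linear : linear avgl.
Proof.
move=> k u v; apply/ffunP=> p; rewrite !ffunE /GRing.scale /=.
under eq_bigr => a _ do rewrite !ffunE.
by rewrite big_split /= -scaler_sumr mulrDr -scalerAr.
Qed.
HB.instance Definition _ :=
  GRing.isLinear.Build R tensor tensor _ avgl avgl_is_linear.

Lemma avgr_is_linear : linear avgr.
Proof.
move=> k u v; apply/ffunP=> p; rewrite !ffunE /GRing.scale /=.
under eq_bigr => a _ do rewrite !ffunE.
by rewrite big_split /= -scaler_sumr mulrDr -scalerAr.
Qed.
HB.instance Definition _ :=
  GRing.isLinear.Build R tensor tensor _ avgr avgr_is_linear.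

Lemma avgl_tens (u : Defs.space R A) (v : Defs.space R B) :
  avgl (tens u v) = tens (avg u) v.
Proof.
apply/ffunP=> p; rewrite !ffunE -mulrA mulr_suml.
by congr (_ * _); apply: eq_bigr => a _; rewrite !ffunE.
Qed.

Lemma avgr_tens (u : Defs.space R A) (v : Defs.space R B) :
  avgr (tens u v) = tens u (avg v).
Proof.
apply/ffunP=> p; rewrite !ffunE [RHS]mulrCA [in RHS]mulr_sumr.
by congr (_ * _); apply: eq_bigr => a _; rewrite !ffunE.
Qed.

(** The kernel of f - g is a subspace containing the products, hence contains [tensv U V] by
    minimality. *)
Lemma tensv_lfun_eq (f g : {linear tensor -> tensor})
    (U : {vspace Defs.space R A}) (V : {vspace Defs.space R B}) T :
    (forall u v, u \in U -> v \in V -> f (tens u v) = g (tens u v)) ->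
  T \in tensv U V -> f T = g T.
Proof.
move=> fg; have/subvP UVK : (tensv U V <= lker (linfun f - linfun g))%VS.
  apply: tensv_min => u v Uu Vv.
  by rewrite memv_ker add_lfunE opp_lfunE !lfunE /= fg ?subrr.
by move/UVK; rewrite memv_ker add_lfunE opp_lfunE !lfunE subr_eq0 => /eqP.
Qed.

Lemma avgl_Cspace V T : T \in tensv (Cspace R A) V -> avgl T = 0.
Proof.
apply: (tensv_lfun_eq (f := avgl) (g := \0)) => u v Cu _ /=.
(* The zero factor is written as 0 *: 0, so that the scalar 0 can be pulled out of the product. *)
by rewrite avgl_tens Cspace_avg // -(scale0r 0) tensZl scale0r.
Qed.

Lemma avgr_Cspace U T : T \in tensv U (Cspace R B) -> avgr T = 0.
Proof.
apply: (tensv_lfun_eq (f := avgr) (g := \0)) => u v _ Cv /=.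
by rewrite avgr_tens Cspace_avg // -(scale0r 0) tensZr scale0r.
Qed.

Lemma avgl_Zspace V T : T \in tensv (Zspace R A) V -> avgl T = T.
Proof.
apply: (tensv_lfun_eq (f := avgl) (g := idfun)) => u v Zu _ /=.
by rewrite avgl_tens Zspace_avg.
Qed.

Lemma avgr_Zspace U T : T \in tensv U (Zspace R B) -> avgr T = T.
Proof.
apply: (tensv_lfun_eq (f := avgr) (g := idfun)) => u v _ Zv /=.
by rewrite avgr_tens Zspace_avg.
Qed.

(** * Directness of the nonsignaling sum *)

Lemma directv_nonsig :
  directv (tensv (Zspace R A) (Cspace R B) + tensv (Cspace R A) (Zspace R B)
           + tensv (Cspace R A) (Cspace R B)).
Proof.
(* Two intersections must vanish: that of the first two summands, and that of their sum with the
   third. *)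
rewrite directv_addE /= directv_addE /= !directvE /= !eqxx /=.
apply/andP; split; rewrite -subv0; apply/subvP=> T; rewrite memv_cap memv0.
  by case/andP=> ZC CZ; rewrite -(avgl_Zspace ZC) (avgl_Cspace CZ).
case/andP=> /memv_addP[T1 ZC [T2 CZ ->]] CC.
(* [avgl] kills T1 + T2 and T2 but fixes T1, so T1 = 0; then [avgr] kills the remaining T2 and also
   fixes it. *)
have T10 : T1 = 0.
  have := avgl_Cspace CC.
  by rewrite linearD /= (avgl_Zspace ZC) (avgl_Cspace CZ) addr0.
have := avgr_Cspace CC; rewrite T10 add0r (avgr_Zspace CZ) => ->.
exact: eqxx.
Qed.

(** * Expansion of a behavior in products of kets *)

Lemma tensor_sum_ket (P : tensor) :
  P = \sum_o \sum_o' P (o, o') *: tens (ket R (tagged o)) (ket R (tagged o')).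
Proof.
apply/ffunP=> -[o o']; rewrite sum_ffunE (bigD1 o) //= sum_ffunE (bigD1 o') //=.
rewrite !ffunE !out_tagged !eqxx /GRing.scale /= !mulr1.
rewrite big1 => [|b bo]; last first.
  by rewrite !ffunE !out_tagged /GRing.scale /= (eq_sym o') (negPf bo) !mulr0.
rewrite addr0 big1 ?addr0 // => a ao; rewrite sum_ffunE big1 // => b _.
by rewrite !ffunE !out_tagged /GRing.scale /= (eq_sym o) (negPf ao) mul0r mulr0.
Qed.

(** The uniform vectors depend only on the inputs, so for each pair of inputs the coefficients can
    be summed over the outputs, which gives 1. *)
Lemma behavior_sum_uniform (P : tensor) : behavior P ->
  \sum_o \sum_o' P (o, o') *: tens (uniform R (tag o)) (uniform R (tag o'))
  = tens (Zvec R A) (Zvec R B).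
Proof.
case=> _ P1; rewrite -!sum_uniform tens_sum sum_outcome; apply: eq_bigr => x _.
under eq_bigr => a _ do rewrite sum_outcome.
rewrite exchange_big; apply: eq_bigr => y _ /=.
under eq_bigr => a _ do rewrite -scaler_suml.
by rewrite -scaler_suml P1 scale1r.
Qed.

End Bipartite.

Theorem proposition10 (R : realType) (A B : cardinality) :
  directv (tensv (Zspace R A) (Cspace R B) + tensv (Cspace R A) (Zspace R B)
           + tensv (Cspace R A) (Cspace R B)) /\
  forall P : tensor_space R A B, behavior P ->
    exists Pnonsig PAtoB PBtoA : tensor_space R A B,
      [/\ P = tens (Zvec R A) (Zvec R B) + Pnonsig + PAtoB + PBtoA,
          Pnonsig \in (tensv (Zspace R A) (Cspace R B)
                       + tensv (Cspace R A) (Zspace R B)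
                       + tensv (Cspace R A) (Cspace R B))%VS,
          PAtoB \in tensv (Sspace R A) (Cspace R B) &
          PBtoA \in tensv (Cspace R A) (Sspace R B)].
Proof.
split=> [|P behP]; first exact: directv_nonsig.
(* [S F] is the expansion of P with each product of kets replaced by a value of F; identities and
   memberships can thus be checked for one pair of outcomes at a time. *)
pose S (F : outcome A -> outcome B -> tensor_space R A B) :=
  \sum_o \sum_o' P (o, o') *: F o o'.
have SD F G : S (fun o o' => F o o' + G o o') = S F + S G.
  rewrite -big_split; apply: eq_bigr => o _ /=; rewrite -big_split.
  by apply: eq_bigr => o' _; rewrite scalerDr.
have S_mem F (W : {vspace tensor_space R A B}) :
    (forall o o', F o o' \in W) -> S F \in W.
  by move=> FW; do 2!apply: memv_suml => ? _; apply: memvZ.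
pose cA : R := (inputs A)%:R^-1.
pose cB : R := (inputs B)%:R^-1.
(* In a mixed term the uniform factor splits by [uniformE]: its Z part goes to the nonsignaling
   component, its S part to a signaling one. The scalars [cA] and [cB] come from this splitting. *)
pose ZC := S (fun o o' => cA *: tens (Zvec R A) (ketC R o')).
pose CZ := S (fun o o' => cB *: tens (ketC R o) (Zvec R B)).
pose CC := S (fun o o' => tens (ketC R o) (ketC R o')).
pose SC := S (fun o o' => cA *: tens (Svec R (tag o)) (ketC R o')).
pose CS := S (fun o o' => cB *: tens (ketC R o) (Svec R (tag o'))).
exists (ZC + CZ + CC), SC, CS; split.
(* Z (x) Z is turned back into an expansion with coefficients P, so that both sides are values of
   [S] and can be compared termwise. *)
- rewrite -(behavior_sum_uniform behP) {1}[P]tensor_sum_ket.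
  rewrite -/(S (fun o o' => tens (uniform R (tag o)) (uniform R (tag o')))).
  rewrite -!SD; apply: eq_bigr => o _; apply: eq_bigr => o' _; congr (_ *: _).
  rewrite !ketE tensDD.
  have -> : tens (uniform R (tag o)) (ketC R o') =
      cA *: tens (Svec R (tag o)) (ketC R o')
      + cA *: tens (Zvec R A) (ketC R o').
    by rewrite uniformE tensZl tensDl scalerDr.
  have -> : tens (ketC R o) (uniform R (tag o')) =
      cB *: tens (ketC R o) (Svec R (tag o'))
      + cB *: tens (ketC R o) (Zvec R B).
    by rewrite uniformE tensZr tensDr scalerDr.
  (* The six summands on the left are the terms of CC, CS, CZ, SC, ZC and the product of uniform
     vectors, in this order. *)
  by rewrite [LHS](AC ((1*(1*1))*((1*1)*1)) (6*(5*3*1)*4*2)).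
- by rewrite !memv_add //; apply: S_mem => o o'; rewrite ?memvZ // tensv_mem
    ?memv_line ?mem_ketC.
- by apply: S_mem => o o'; rewrite memvZ // tensv_mem ?mem_Svec ?mem_ketC.
- by apply: S_mem => o o'; rewrite memvZ // tensv_mem ?mem_Svec ?mem_ketC.
Qed.
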